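(* For every $m\ge 1$, there are infinitely many pairs $(n,k)$ such that $H_{n+i,k+j}$ is composite for all $i,j\in \{1,\ldots,m\}$.
   Context: Let $F_n$ denote the Fibonacci numbers ($F_0=0$, $F_1=1$, $F_{n+2}=F_{n+1}+F_n$). For positive integers $r,k$, the entries of the determinant Hosoya triangle are $H_{r,k}=\begin{vmatrix} F_{k+1} & F_{k}\\ F_{r-k+1} & F_{r-k+2}\end{vmatrix}=F_{k+1}F_{r-k+2}-F_kF_{r-k+1}=F_{k-1}F_{r-k+2}+F_{k}F_{r-k}$, where $r$ is the line and $k$ the position in the line (with $1\le k\le r$). *)

(* Defs.v *)
From mathcomp Require Import all_boot all_order all_algebra.
From mathcomp Require Import ring.
Set Implicit Arguments.
Unset Strict Implicit.
Unset Printing Implicit Defensive.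
Import Order.TTheory GRing.Theory Num.Theory.
Local Open Scope ring_scope.

Fixpoint fib (n : nat) : nat :=
  match n with
  | 0 => 0
  | n'.+1 => match n' with 0 => 1 | n''.+1 => fib n' + fib n'' end
  end%N.

(* The index subtraction r - k is truncated, so this is the entry of the
   triangle only when 1 <= k <= r. *)
Definition hosoya_mx (r k : nat) : 'M[int]_2 :=
  \matrix_(i, j)
    if i == 0 then (if j == 0 then (fib (k + 1))%:Z else (fib k)%:Z)
    else (if j == 0 then (fib (r - k + 1))%:Z else (fib (r - k + 2))%:Z).

Definition hosoya (r k : nat) : int := \det (hosoya_mx r k).

Definition composite (z : int) : bool := (1 < z) && ~~ prime `|z|%N.

Lemma hosoyaE (r k : nat) :
  hosoya r k = (fib (k + 1))%:Z * (fib (r - k + 2))%:Z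
             - (fib k)%:Z * (fib (r - k + 1))%:Z.
Proof.
rewrite /hosoya (expand_det_row _ 0) !big_ord_recl big_ord0 addr0.
rewrite /cofactor !det_mx11 !mxE /= expr0 expr1 mul1r mulN1r mulrN.
by [].
Qed.

Lemma hosoya_addE (r k : nat) : (1 <= k <= r)%N ->
  hosoya r k = (fib (k - 1) * fib (r - k + 2) + fib k * fib (r - k))%:Z.
Proof.
case: k => // k _; rewrite hosoyaE subSS subn0.
set d := (r - k.+1)%N; rewrite !addn2 !addn1.
have fibSS n : fib n.+2 = (fib n.+1 + fib n)%N by [].
rewrite (fibSS k) (fibSS d).
rewrite !(PoszD, PoszM); ring.
Qed.

(* Main.v *)
(** Fibonacci numbers are purely periodic modulo any M > 0.  Take a fixed m x m
    block of the triangle whose entries exceed 1 and let M be a positive common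
    multiple of them.  Moving the block down by a positive multiple of a period
    modulo M preserves every entry modulo M, so each new entry is divisible by
    the entry it came from; since it is also strictly larger, it is composite. *)
Require Import Defs.
From mathcomp Require Import all_boot all_order all_algebra.
From mathcomp Require Import zify.
From mathcomp Require Import classical_sets cardinality.
Local Open Scope classical_set_scope.

Lemma fibSS n : fib n.+2 = fib n.+1 + fib n.
Proof. by []. Qed.

Lemma fib_gt0 n : 0 < n -> 0 < fib n.
Proof.
case: n => // n _; elim: n => // n IHn.
by rewrite fibSS addn_gt0 IHn.
Qed.

Lemma leq_fib a b : a <= b -> fib a <= fib b.
Proof.
move=> /subnK <-; elim: (b - a) => // n IHn.
apply: leq_trans IHn _; rewrite addSn.
by case: (n + a) => // c; rewrite fibSS leq_addr.
Qed.

(** The shift by two avoids the tie [fib 1 = fib 2]. *)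
Lemma ltn_fibSS a b : a < b -> fib a.+2 < fib b.+2.
Proof.
move=> lt_ab; apply: (@leq_trans (fib a.+3)); last exact: leq_fib.
by rewrite (fibSS a.+1) -[ltnLHS]addn0 ltn_add2l fib_gt0.
Qed.

Section FibPair.
Import GRing.Theory.
Local Open Scope ring_scope.

Definition fib_step (V : zmodType) (x : V * V) : V * V := (x.2, x.2 + x.1).

Lemma fib_step_inj (V : zmodType) : injective (@fib_step V).
Proof. by move=> [a b] [c d] [-> /addrI ->]. Qed.

Lemma iter_fib_step (R : nzRingType) n :
  iter n (@fib_step R) (0, 1) = ((fib n)%:R, (fib n.+1)%:R).
Proof. by elim: n => //= n ->; rewrite /fib_step /= -natrD. Qed.

End FibPair.

(* The step (a, b) |-> (b, a + b) is a permutation of a finite set, so the orbit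
   of (0, 1) is a cycle. *)
Lemma fib_periodic M : 0 < M ->
  exists2 P, 0 < P & forall n, fib (n + P) = fib n %[mod M].
Proof.
(* The modulus 1 is treated apart, since ['Z_1] is by convention the ring of integers modulo 2. *)
case: M => // [[_|M _]]; first by exists 1 => // n; rewrite !modn1.
pose f := @fib_step 'Z_M.+2; pose x := (0, 1)%R : 'Z_M.+2 * 'Z_M.+2.
exists (order f x) => [|n]; first exact: order_gt0.
have : iter (n + order f x) f x = iter n f x.
  by rewrite iterD iter_order //; exact: fib_step_inj.
by rewrite !iter_fib_step => -[/(congr1 val)]; rewrite /= !val_Zp_nat.
Qed.

Lemma fib_periodic_mul M P : (forall n, fib (n + P) = fib n %[mod M]) ->
  forall n s, fib (n + P * s) = fib n %[mod M].
Proof.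
move=> perP n; elim=> [|s IHs]; first by rewrite muln0 addn0.
by rewrite mulnSr addnA perP.
Qed.

(* [hos k b] is the entry on line [k + 1 + b] at position [k + 1]. *)
Definition hos (k b : nat) : nat := fib k * fib b.+2 + fib k.+1 * fib b.

Lemma hosoya_hos k b : hosoya (k.+1 + b) k.+1 = hos k b.
Proof.
by rewrite hosoya_addE ?leq_addr // subSS subn0 addKn addn2.
Qed.

Lemma hos_gt0 k b : 0 < k + b -> 0 < hos k b.
Proof.
rewrite addn_gt0 /hos addn_gt0 !muln_gt0 => /orP[/fib_gt0 -> | /fib_gt0 ->].
  by rewrite fib_gt0.
by rewrite (fib_gt0 k.+1) ?orbT.
Qed.

Lemma hos_gt1 k b : 0 < k -> 0 < b -> 1 < hos k b.
Proof.
move=> /fib_gt0 k_gt0 /fib_gt0 b_gt0; rewrite /hos -[2]/(1 + 1).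
by apply: leq_add; rewrite muln_gt0 ?k_gt0 ?b_gt0 ?andbT fib_gt0.
Qed.

(** Strictness comes from the term in [fib b.+2]; the term in [fib b] may tie. *)
Lemma ltn_hos k b c : 0 < k -> b < c -> hos k b < hos k c.
Proof.
move=> /fib_gt0 k_gt0 lt_bc; rewrite /hos -addSn; apply: leq_add.
  by rewrite ltn_pmul2l // ltn_fibSS.
by rewrite leq_mul2l leq_fib ?orbT // ltnW.
Qed.

Lemma hos_mod M k b c :
  (forall n, fib (n + c) = fib n %[mod M]) -> hos k (b + c) = hos k b %[mod M].
Proof.
move=> per; rewrite /hos -!addSn -modnDm -[in RHS]modnDm.
by rewrite -modnMmr per modnMmr -[(fib k.+1 * _) %% M]modnMmr per modnMmr.
Qed.

Lemma composite_dvdn (d n : nat) : 1 < d -> d < n -> d %| n -> composite n.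
Proof.
move=> d_gt1 lt_dn dvd_dn; rewrite /composite ltz_nat (ltn_trans d_gt1) //=.
apply/primePn; right; exists d => //.
by rewrite d_gt1.
Qed.

Theorem theorem3p1 (m : nat) (hm : (1 <= m)%N) :
  infinite_set [set p : nat * nat |
    [/\ (1 <= p.1)%N, (1 <= p.2)%N &
        forall i j : nat, (1 <= i <= m)%N -> (1 <= j <= m)%N ->
          (p.2 + j <= p.1 + i)%N /\ composite (hosoya (p.1 + i) (p.2 + j))]].
Proof.
(* The factor at [i], [j] is the entry on line [m + 1 + i] at position [j + 1]; as [j <= m], the
   subtraction is not truncated. *)
pose M := \prod_(i < m.+1) \prod_(j < m.+1) hos j (m + i - j).
have M_gt0 : 0 < M.
  apply: prodn_gt0 => i; apply: prodn_gt0 => j; apply: hos_gt0.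
  by have := ltn_ord j; lia.
have hos_dvd i j : i <= m -> j <= m -> hos j (m + i - j) %| M.
  rewrite -[i <= m]ltnS -[j <= m]ltnS => hi hj; rewrite /M (bigD1 (Ordinal hi)) //=.
  by rewrite (bigD1 (Ordinal hj)) //= -mulnA dvdn_mulr.
have [P P_gt0 /fib_periodic_mul perP] := fib_periodic _ M_gt0.
(* The block moves straight down, positions fixed; [s.+1] keeps the shift positive, so that every
   entry strictly grows. *)
pose g s := (m.+1 + P * s.+1, 1).
have g_inj : injective g.
  by move=> s t [] /addnI/eqP; rewrite eqn_pmul2l // => /eqP[].
apply: (@sub_infinite_set _ (g @` [set: nat])); last first.
  have /card_eqPle[_ le_g] := inj_card_eq (in2W g_inj : {in [set: nat] &, injective g}).
  by move=> /(card_le_finite le_g)/infinite_nat.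
move=> _ [s _ <-]; split=> //= i j /andP[i_gt0 le_im] /andP[j_gt0 le_jm].
split; first by lia.
have -> : m.+1 + P * s.+1 + i = j.+1 + (m + i - j + P * s.+1) by lia.
rewrite add1n hosoya_hos; apply: (@composite_dvdn (hos j (m + i - j))).
- by apply: hos_gt1 => //; lia.
- by apply: ltn_hos => //; rewrite -[ltnLHS]addn0 ltn_add2l muln_gt0 P_gt0.
have dM := hos_dvd i j le_im le_jm.
(* The congruence modulo [M] descends to the old entry, a divisor of [M], and there the old entry is
   0. *)
have := hos_mod M j (m + i - j) (P * s.+1) (fun n => perP n s.+1).
by move=> /(congr1 (modn^~ (hos j (m + i - j)))); rewrite !modn_dvdm // modnn => /eqP.
Qed.
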